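(* For a periodic direction in the 3rd sector, let $(c,d,e,f)$ and $(C,D,E,F)$ be the vectors whose components are the numbers of symbols ${\rm I},{\rm II},{\rm III},{\rm IV}$ in the short and in the long Roman cyclic symbolic orbit of this direction, respectively. Then $$C=c+e,\qquad D=f,\qquad E=c,\qquad F=d+f.$$
   Context: Let $P$ be a regular plane pentagon of side $1$ with a horizontal side at the bottom; label its sides, counterclockwise starting from the bottom side, by $3,5,2,4,1$. Let $P'=-P$ be its centrally symmetric copy; the side of $P'$ parallel to side $i$ of $P$ is also labelled $i$. The double pentagon $X$ is the flat surface obtained from $P\sqcup P'$ by gluing, for each $i$, the two sides labelled $i$ by a parallel translation. Directions of linear trajectories on $X$ are considered modulo $180^\circ$; the 3rd sector is the set of directions making an angle $\theta$ with the horizontal (counterclockwise) such that $72^\circ\le\theta\le108^\circ$. A direction is periodic if there are closed linear trajectories in this direction; then $X$ decomposes into two strips of parallel closed trajectories in this direction. The symbolic orbit of a closed trajectory is the word in $1,\dots,5$ formed by the labels of the sides consecutively crossed in one traversal, considered up to cyclic permutation; it is the same for all trajectories of one strip. The short (long) symbolic orbit of a periodic direction is that of the strip whose trajectories have the smaller (larger) length. For a direction in the 3rd sector the symbolic orbit splits into consecutive two-letter blocks, each being one of $43,41,25,23$; replacing $43\to{\rm I}$, $41\to{\rm II}$, $25\to{\rm III}$, $23\to{\rm IV}$ gives the Roman cyclic symbolic orbit. *)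

(* Defs.v *)
From HB Require Import structures.
From mathcomp Require Import all_boot all_order all_algebra.
From mathcomp Require Import reals trigo.

Set Implicit Arguments.
Unset Strict Implicit.
Unset Printing Implicit Defensive.

Import Order.TTheory GRing.Theory Num.Theory.
Local Open Scope ring_scope.

Section DoublePentagon.
Variable R : realType.

(* The Euclidean plane; only its vector space structure is used, lengths are
   measured along unit vectors. *)
Definition plane := (R^o * R^o)%type.

Definition dir (theta : R) : plane := (cos theta, sin theta).

Definition deg (x : R) : R := x * pi / 180.

(* The vertices of P, counterclockwise from the left end of the bottom side:
   side k runs from vertex k to vertex k.+1, has length 1 and makes the angle
   72 k degrees with the horizontal; vertex 5 is vertex 0 again. *)
Definition vertex (k : nat) : plane := \sum_(j < k) dir (deg (72 * j%:R)).

Definition label (k : 'I_5) : nat := nth 0 [:: 3; 5; 2; 4; 1]%N k.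

(* The polygon P is encoded by false and P' = - P by true; p lies on side k of
   the polygon b and is not an endpoint of it. *)
Definition on_side (b : bool) (k : 'I_5) (p : plane) : Prop :=
  exists2 t : R, 0 < t < 1
  & p = (-1) ^+ b *: ((1 - t) *: vertex k + t *: vertex k.+1).

(* The translation by which side k of the polygon b is glued to side k of the
   other polygon: for b = false it maps vertex k to - vertex k.+1 and
   vertex k.+1 to - vertex k. *)
Definition gluing (b : bool) (k : 'I_5) (p : plane) : plane :=
  p - (-1) ^+ b *: (vertex k + vertex k.+1).

(* A maximal segment of a linear trajectory inside one of the two polygons. *)
Record chord := Chord {
  polygon : bool;
  side_in : 'I_5;
  side_out : 'I_5;
  start : plane;
  chord_length : R }.

Definition finish (theta : R) (c : chord) : plane :=
  start c + chord_length c *: dir theta.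

(* The polygons being convex, a segment between interior points of two
   different sides has its relative interior inside the polygon. *)
Definition is_chord (theta : R) (c : chord) : Prop :=
  [/\ on_side (polygon c) (side_in c) (start c),
      on_side (polygon c) (side_out c) (finish theta c),
      side_in c != side_out c & 0 < chord_length c].

Definition continues (theta : R) (c c' : chord) : bool :=
  [&& polygon c' == ~~ polygon c, side_in c' == side_out c
    & start c' == gluing (polygon c) (side_out c) (finish theta c)].

(* A closed trajectory in the direction theta, avoiding the vertices, given by
   its successive chords in one traversal: the last chord is continued by the
   first one, and uniqueness of the starting points means that the trajectory
   is traversed only once. *)
Definition closed_trajectory (theta : R) (s : seq chord) : Prop :=
  [/\ s <> [::],
      forall i : 'I_(size s), is_chord theta (tnth (in_tuple s) i),
      cycle (continues theta) s
    & uniq [seq (polygon c, start c) | c <- s]].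

Definition trajectory_length (s : seq chord) : R :=
  \sum_(c <- s) chord_length c.

Definition periodic_direction (theta : R) : Prop :=
  exists s, closed_trajectory theta s.

(* The angle theta represents the direction modulo 180 degrees in such a way
   that trajectories are traversed upwards. *)
Definition sector3 (theta : R) : Prop := deg 72 <= theta <= deg 108.

(* A representative of the symbolic orbit, which is a cyclic word. *)
Definition symbolic_orbit (s : seq chord) : seq nat :=
  [seq label (side_out c) | c <- s].

(* In a periodic direction there are two strips, with trajectories of two
   different lengths, so that a closed trajectory belongs to the short (long)
   strip when some closed trajectory of this direction is longer (shorter). *)
Definition short_trajectory (theta : R) (s : seq chord) : Prop :=
  closed_trajectory theta s /\
  exists2 s', closed_trajectory theta s'
  & trajectory_length s < trajectory_length s'.

Definition long_trajectory (theta : R) (s : seq chord) : Prop :=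
  closed_trajectory theta s /\
  exists2 s', closed_trajectory theta s'
  & trajectory_length s' < trajectory_length s.

End DoublePentagon.

Inductive roman := rI | rII | rIII | rIV.

Definition block (x : roman) : seq nat :=
  match x with
  | rI => [:: 4; 3]
  | rII => [:: 4; 1]
  | rIII => [:: 2; 5]
  | rIV => [:: 2; 3]
  end%N.

Lemma block_inj : injective block.
Proof. by case; case. Qed.

HB.instance Definition _ := Equality.copy roman (inj_type block_inj).

(* The cyclic word r is obtained from the cyclic word w by splitting w into
   two-letter blocks; the rotation takes care of the place where the first
   block starts in w. *)
Definition roman_of (w : seq nat) (r : seq roman) : Prop :=
  exists n : nat, flatten [seq block x | x <- r] = rot n w.

Definition short_roman_orbit (R : realType) (theta : R) (r : seq roman) :
    Prop :=
  exists2 s, short_trajectory theta s & roman_of (symbolic_orbit s) r.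

Definition long_roman_orbit (R : realType) (theta : R) (r : seq roman) : Prop :=
  exists2 s, long_trajectory theta s & roman_of (symbolic_orbit s) r.

(* Main.v *)
Require Import Defs.
From HB Require Import structures.
From mathcomp Require Import all_boot all_order all_algebra.
From mathcomp Require Import reals trigo.
From mathcomp Require Import boolp ring lra zify.

Set Implicit Arguments.
Unset Strict Implicit.
Unset Printing Implicit Defensive.

Import Order.TTheory GRing.Theory Num.Theory.
Local Open Scope ring_scope.

(** Project the surface along the direction theta.  A trajectory alternates
    between P and P' = - P, and a passage through P' meets two sides whose
    labels form one of the four blocks; so the passages through P' are the
    steps of an exchange of four intervals, one for each Roman letter, and a
    closed trajectory is a periodic orbit of this exchange.  Let u and v be
    the widths, seen in the direction theta, of the sides labelled 5 and 1,
    and let phi be the golden ratio 2 cos 36.  The intervals I, II, III, IV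
    have lengths phi u, v, u, phi v; they are found in the order
    I, II, III, IV and moved to the order II, IV, I, III ([pent_iet],
    [flipped_chord], [linked_entry]).

    This family of exchanges is closed under Rauzy induction, which cuts off
    an extreme interval and passes to the first return map.  Up to the
    symmetry exchanging u and v, three steps lead from (u, v) to
    (u - phi v, v) when phi v <= u ([visits_pent_iet_far]), and five steps
    lead to (phi (u - v), phi v - u) when v <= u <= phi v
    ([visits_pent_iet_near]).  Every periodic orbit of the original exchange
    induces one of the new exchange, and the letter counts of the former are
    obtained from those of the latter by a matrix with natural entries which
    depends on the case only.  The counts strictly decrease, so in the
    presence of a periodic orbit the process reaches v = 0 (or u = 0), where
    the exchange is the identity and the periodic orbits are the points of
    the two remaining intervals.

    Group the counts (c, d, e, f) into the pair (phi c + e, phi f + d) over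
    Z[phi].  The map (c, d, e, f) |-> (c + e, f, c, d + f) is multiplication
    by phi ([golden_mul]); the matrices above are Z[phi]-linear in these
    coordinates, so they commute with it.  For v = 0 the two count vectors
    are those of the letters III and I, and the second is the image of the
    first by [golden_mul]; hence in every periodic direction the only count
    vectors are some P and its image ([visits_pent_iet_dichotomy]).  The
    vertical component of the holonomy is at least as large for the image as
    for P, so P belongs to the shorter trajectories and its image to the
    longer ones. *)

(** * Cyclic sequences *)

Lemma cycle_sum (T : Type) (V : nmodType) (e : rel T) (F G : T -> V) s :
  (forall x y, e x y -> F y = G x) -> cycle e s ->
  \sum_(x <- s) F x = \sum_(x <- s) G x.
Proof.
move=> FG; case: s => [|x0 s] /=; first by rewrite !big_nil.
have shift x p : path e x p ->
    \sum_(y <- p) F y = \sum_(y <- belast x p) G y.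
  elim: p x => [|y p IHp] x /=; first by rewrite !big_nil.
  by case/andP=> exy /IHp; rewrite !big_cons (FG _ _ exy) => ->.
by move/shift; rewrite belast_rcons big_rcons => <-; rewrite big_cons addrC.
Qed.

Lemma sum_pred (T : Type) (P : pred T) s : (\sum_(x <- s) P x = count P s)%N.
Proof.
by rewrite -sum1_count [RHS]big_mkcond; apply: eq_bigr => x; case: (P x).
Qed.

Lemma cycle_count (T : Type) (e : rel T) (P Q : pred T) s :
  (forall x y, e x y -> Q y = P x) -> cycle e s -> count P s = count Q s.
Proof.
move=> PQ es; rewrite -!sum_pred; symmetry.
by apply: (cycle_sum (V := nat)) es => x y /PQ ->.
Qed.

(** A first return map: when a cycle never stays outside p for two
    consecutive terms, deleting the terms outside p leaves a cycle for the
    relation that shortcuts them. *)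
Lemma cycle_filter (T : Type) (e e' : rel T) (p : pred T) s :
    (forall x y, e x y -> p x || p y) ->
    (forall x y, e x y -> p x -> p y -> e' x y) ->
    (forall x y z, e x y -> e y z -> ~~ p y -> e' x z) ->
  cycle e s -> cycle e' (filter p s).
Proof.
move=> epp e1 e2.
have skip m x t : (size t < m)%N -> p x -> p (last x t) ->
    path e x t -> path e' x (filter p t).
  elim: m x t => // m IHm x [|y t] //=; rewrite ltnS => ltm px pl /andP[exy et].
  have [py|npy] /= := boolP (p y).
    by rewrite (e1 _ _ exy px py) IHm.
  case: t => [|z t] /= in ltm pl et *; first by rewrite (negPf npy) in pl.
  case/andP: et => eyz et; have := epp _ _ eyz; rewrite (negPf npy) /= => pz.
  by rewrite pz /= (e2 _ _ _ exy eyz npy) IHm // ltnW.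
have none t : ~~ has p t -> filter p t = [::].
  by elim: t => //= x t IHt; rewrite negb_or => /andP[/negPf -> /IHt].
have [|/none -> //] := boolP (has p s).
case/split_find => x s1 s2 px /none s1_none.
rewrite filter_cat filter_rcons px s1_none.
rewrite -(rot_cycle (size s1)) cat_rcons rot_size_cat /= => es.
have := skip _ x _ (ltnSn _) px _ es; rewrite last_rcons => /(_ px).
by rewrite filter_rcons px filter_cat s1_none cats0.
Qed.

Lemma uniq_map_inj (T U : eqType) (f : T -> U) s :
  uniq (map f s) -> {in s &, injective f}.
Proof.
elim: s => //= x s IHs /andP[fx us] y z; rewrite !inE.
case/predU1P=> [->|ys] /predU1P[->|zs] // fyz; last exact: IHs.
- by rewrite fyz map_f in fx.
- by rewrite -fyz map_f in fx.
Qed.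

(** * Interval exchanges and Rauzy induction *)
Section Iet.
Variables (R : realFieldType).

(** The interval of letter a starts at dom a, has length len a, and is
    translated so as to start at img a.  What the induction uses of the
    arrangement of the intervals is recorded in [right_cut]. *)
Record iet (A : Type) := Iet { dom : A -> R; img : A -> R; len : A -> R }.

(** Points carry the letter of the interval that contains them, which makes
    the itinerary of an orbit a projection. *)
Definition inside A (E : iet A) (p : A * R) : bool :=
  dom E p.1 < p.2 < dom E p.1 + len E p.1.

Definition moves A (E : iet A) : rel (A * R) :=
  fun p q => [&& inside E p, inside E q & q.2 == p.2 - dom E p.1 + img E p.1].

Definition periodic_orbit (A : eqType) (E : iet A) (s : seq (A * R)) : bool :=
  [&& s != [::], cycle (moves E) s & uniq s].

Definition visits (A : eqType) (E : iet A) (n : A -> nat) : Prop :=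
  exists2 s, periodic_orbit E s & forall a, count (fun p => p.1 == a) s = n a.

Lemma cycle_inside A (E : iet A) s : cycle (moves E) s -> all (inside E) s.
Proof.
case: s => //= x s; have pin y t : path (moves E) y t -> all (inside E) t.
  by elim: t y => //= z t IHt y /andP[/and3P[_ -> _] /IHt].
by move/pin; rewrite all_rcons.
Qed.

(** One step of Rauzy induction at the right end, when the last interval w of
    the domain is at least as long as the last interval l of the image.  The
    part of the segment covered by the image of l is removed; it lies in w.
    Points of l then jump over the removed part and follow w, whence the new
    position of the image of l. *)
Definition right_cut (A : eqType) (w l : A) (E E' : iet A) : Prop :=
  [/\ w != l, dom E w + len E w = img E l + len E l, len E l <= len E w
    & forall a,
      [/\ a != w -> dom E a + len E a <= dom E w,
          a != l -> img E a + len E a <= img E l,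
          dom E' a = dom E a,
          len E' a = (if a == w then len E w - len E l else len E a)
        & img E' a = (if a == l then img E w + (len E w - len E l)
                      else img E a)]].

(** Each visit to the removed part comes right after a visit to l and counts
    as a visit to the winner w, so w loses as many visits as l has.  As w and
    l differ, an orbit never stays in the removed part, hence is not lost. *)
Lemma visits_right_cut (A : eqType) w l (E E' : iet A) n :
    right_cut w l E E' -> visits E n ->
  exists2 n', visits E' n'
  & n w = (n' w + n l)%N /\ forall a, a != w -> n a = n' a.
Proof.
case=> wl eqwl lelw hE [s /and3P[s0 cs us] ns].
pose keep (q : A * R) := q.2 < img E l.
have keep_next p q : moves E p q -> keep q = (p.1 != l).
  case/and3P=> /andP[p1 p2] _ /eqP qE; rewrite /keep qE.
  have [pl|npl] := eqVneq p.1 l; apply/idP.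
    by apply/negP; rewrite -leNgt; rewrite pl in p1 *; lra.
  have [_ /(_ npl) h _ _ _] := hE p.1; move=> /=; lra.
have cut_w q : inside E q -> ~~ keep q -> q.1 = w.
  move=> /andP[_ q2]; rewrite /keep -leNgt => kq; apply/eqP/negPn/negP => nqw.
  by have [/(_ nqw) h _ _ _ _] := hE q.1; lra.
have keep_pair p q : moves E p q -> keep p || keep q.
  move=> epq; have [//|nkp] := boolP (keep p).
  by rewrite (keep_next _ _ epq) (cut_w p) //; case/and3P: epq.
have inside' q : inside E q -> keep q -> inside E' q.
  rewrite /inside /keep => /andP[q1 q2] kq.
  have [_ _ -> -> _] := hE q.1; rewrite q1.
  by case: eqP => [qw|_]; rewrite ?qw in q1 q2 *; lra.
exists (fun a => count (fun p => p.1 == a) (filter keep s)).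
  exists (filter keep s); last by [].
  apply/and3P; split; last exact: filter_uniq.
    rewrite -has_filter; case: s s0 cs {us ns} => // x [|y s] _ /=.
      by rewrite andbT orbF => /keep_pair; rewrite orbb.
    by case/andP=> /keep_pair /orP[] -> //; rewrite orbT.
  apply: (cycle_filter keep_pair _ _ cs) => [p q|p q r].
    move=> /[dup] epq /and3P[ip iq /eqP qE] kp kq; apply/and3P; split.
    - exact: inside'.
    - exact: inside'.
    - have [_ _ -> _ ->] := hE p.1; rewrite qE.
      by rewrite ifN // -(keep_next _ _ epq).
  move=> /[dup] epq /and3P[ip iq /eqP qE] /[dup] eqr /and3P[_ ir /eqP rE] nkq.
  have := keep_next _ _ epq; rewrite (negPf nkq) => /esym/negbFE/eqP pl.
  have qw := cut_w _ iq nkq.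
  apply/and3P; split.
  - apply: inside' => //; have /orP[//|kq] := keep_pair _ _ epq.
    by rewrite kq in nkq.
  - apply: inside' => //; have /orP[kq|//] := keep_pair _ _ eqr.
    by rewrite kq in nkq.
  - have [_ _ -> _ ->] := hE p.1; rewrite pl eqxx rE qE pl qw.
    by apply/eqP; lra.
have countE a : n a = (count (fun p => p.1 == a) (filter keep s)
               + (if a == w then n l else 0))%N.
  rewrite -ns -size_filter -(count_predC keep) !count_filter; congr addn.
    by apply: eq_count => p; rewrite /= andbC.
  case: eqP => [->|/eqP naw].
    rewrite -ns (@cycle_count _ _ (fun p => p.1 == l) (predC keep) _ _ cs).
      2: by move=> p q /keep_next /= ->; rewrite negbK.
    apply: eq_in_count => p ps /=; case: (boolP (keep p)) => //= nkp.
    by rewrite (cut_w p) ?eqxx // (allP (cycle_inside cs)).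
  apply/eqP; rewrite eqn0Ngt -has_count; apply/hasPn => p ps /=.
  apply/negP => /andP[nkp /eqP pa].
  by rewrite -pa (cut_w p) ?eqxx // (allP (cycle_inside cs)) in naw.
split=> [|a /negPf naw]; first by rewrite [LHS]countE eqxx.
by rewrite [LHS]countE naw addn0.
Qed.

Definition inverse A (E : iet A) := Iet (img E) (dom E) (len E).

Definition mirror A (W : R) (E : iet A) :=
  Iet (fun a => W - (dom E a + len E a)) (fun a => W - (img E a + len E a))
      (len E).

(** The symmetries of interval exchanges: relabelling, reversal of the segment
    and reversal of time.  They give the other three forms of the step from
    the one above. *)
Lemma visits_map (A B : eqType) (E : iet A) (E' : iet B) f g
    (h : A * R -> B * R) n :
    cancel f g -> cancel g f -> injective h -> (forall p, (h p).1 = f p.1) ->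
    (forall p q, moves E p q -> moves E' (h p) (h q)) ->
  visits E n -> visits E' (n \o g).
Proof.
move=> fK gK h_inj h1 hm [s /and3P[s0 cs us] ns].
exists (map h s) => [|b].
  apply/and3P; split; last by rewrite map_inj_uniq.
    by rewrite -size_eq0 size_map size_eq0.
  exact: (homo_cycle hm).
rewrite /= -ns count_map; apply: eq_count => p /=.
by rewrite h1 -(inj_eq (can_inj gK)) fK.
Qed.

Lemma visits_relabel (A B : eqType) f g (E : iet A) (E' : iet B) n :
    cancel f g -> cancel g f ->
    (forall a, [/\ dom E' (f a) = dom E a, img E' (f a) = img E a
                 & len E' (f a) = len E a]) ->
  visits E n -> visits E' (n \o g).
Proof.
move=> fK gK fE; apply: (@visits_map _ _ _ _ f g (fun p => (f p.1, p.2))) => //.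
  by move=> [a x] [b y] /= [/(can_inj fK) -> ->].
move=> [a x] [b y]; rewrite /moves /inside /=.
by have [-> -> ->] := fE a; have [-> _ ->] := fE b.
Qed.

Lemma visits_mirror (A : eqType) W (E E' : iet A) n :
    (forall a, [/\ dom E' a = W - (dom E a + len E a),
                   img E' a = W - (img E a + len E a) & len E' a = len E a]) ->
  visits E n -> visits E' n.
Proof.
move=> fE; apply: (@visits_map _ _ _ _ id id (fun p => (p.1, W - p.2))) => //.
  move=> [a x] [b y] /= [-> /eqP].
  by rewrite (inj_eq (addrI _)) eqr_opp => /eqP ->.
move=> [a x] [b y]; rewrite /moves /inside /=.
have [-> -> ->] := fE a; have [-> _ ->] := fE b.
by case/and3P => ? ? /eqP yE; apply/and3P; split; [lra|lra|apply/eqP; lra].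
Qed.

Lemma visits_inverse (A : eqType) (E : iet A) n :
  visits E n -> visits (inverse E) n.
Proof.
move=> [s /and3P[s0 cs us] ns].
pose h (p : A * R) := (p.1, p.2 - dom E p.1 + img E p.1).
exists (rev (map h s)) => [|a]; last by rewrite count_rev count_map -ns.
apply/and3P; split.
- by rewrite -size_eq0 size_rev size_map size_eq0.
- rewrite rev_cycle; apply: (@homo_cycle _ _ h (moves E)) cs.
  move=> [a x] [b y] /and3P[/= /andP[x1 x2] /andP[y1 y2] /eqP yE].
  rewrite /= in x1 x2 y1 y2 yE *.
  by apply/and3P; split; rewrite /inside /=; [lra|lra|apply/eqP; lra].
- rewrite rev_uniq map_inj_uniq // => [[a x] [b y]] /= [-> /eqP].
  by rewrite !(inj_eq (addIr _)) => /eqP ->.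
Qed.

Lemma visits_right_cut_img (A : eqType) w l (E E' : iet A) n :
    right_cut w l (inverse E) (inverse E') -> visits E n ->
  exists2 n', visits E' n'
  & n w = (n' w + n l)%N /\ forall a, a != w -> n a = n' a.
Proof.
move=> cutE /visits_inverse /(visits_right_cut cutE)[n' /visits_inverse En' ?].
by exists n' => //; case: E' {cutE} En'.
Qed.

(** The reflection points W and W' may differ, which translates the new
    exchange; this is used to start it at the origin again. *)
Lemma visits_left_cut (A : eqType) w l W W' (E E' : iet A) n :
    right_cut w l (mirror W E) (mirror W' E') -> visits E n ->
  exists2 n', visits E' n'
  & n w = (n' w + n l)%N /\ forall a, a != w -> n a = n' a.
Proof.
move=> cutE En; have {En} : visits (mirror W E) n by apply: visits_mirror En.
case/(visits_right_cut cutE)=> n' E'n' ?; exists n' => //.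
by apply: (visits_mirror (W := W')) E'n' => a; split=> //=; ring.
Qed.

End Iet.

(** * Induction in the golden family *)
Section Golden.
Variables (R : realFieldType) (phi : R).
Hypotheses (phi_gt0 : 0 < phi) (phi_sqr : phi * phi = phi + 1).

Definition roman_fun T (a b c d : T) (x : roman) : T :=
  match x with rI => a | rII => b | rIII => c | rIV => d end.

(** The intervals are stacked in the order I, II, III, IV in the domain and
    II, IV, I, III in the image. *)
Definition pent_iet u v : iet R roman :=
  Iet (roman_fun 0 (phi * u) (phi * u + v) (phi * u + v + u))
      (roman_fun (v + phi * v) 0 (v + phi * v + phi * u) v)
      (roman_fun (phi * u) v u (phi * v)).

Lemma phi_ge1 : 1 <= phi.
Proof.
rewrite leNgt; apply/negP => phi_lt1.
have : 0 < phi * (1 - phi) by rewrite mulr_gt0 ?subr_gt0.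
by rewrite mulrBr phi_sqr; lra.
Qed.

(** III wins against IV on the right, then I wins against II and against IV on
    the left.  In the image the order goes from II, IV, I, III to
    IV, II, I, III and back, while the domain keeps its order. *)
Lemma visits_pent_iet_far u v n :
    0 <= v -> phi * v <= u -> visits (pent_iet u v) n ->
  exists2 n', visits (pent_iet (u - phi * v) v) n'
  & [/\ n rI = n' rI + n' rII + n' rIV, n rII = n' rII,
       n rIII = n' rIII + n' rIV & n rIV = n' rIV]%N.
Proof.
move=> v0 vu.
have p1 := phi_ge1.
have f1 : phi * (phi * v) = phi * v + v by rewrite mulrA phi_sqr; ring.
have f2 : phi * (phi * v) <= phi * u by rewrite ler_pM2l.
have f3 : v <= phi * v by rewrite ler_peMl.
have f4 : u <= phi * u by rewrite ler_peMl; lra.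
case/(@visits_right_cut_img _ _ rIII rIV _ (Iet
  (roman_fun 0 (phi * u) (phi * u + v) (phi * u + v + u - phi * v))
  (roman_fun (v + phi * v) 0 (v + phi * v + phi * u) v)
  (roman_fun (phi * u) v (u - phi * v) (phi * v)))).
  by split=> //=; [lra|case; split=> //=; lra].
move=> n1 En1 [w1 o1].
pose W1 := phi * u + v + u.
case/(@visits_left_cut _ _ rI rII W1 W1 _ (Iet
  (roman_fun v (phi * u) (phi * u + v) (phi * u + v + u - phi * v))
  (roman_fun (v + phi * v + v) (v + phi * v) (v + phi * v + phi * u) v)
  (roman_fun (phi * u - v) v (u - phi * v) (phi * v)))): En1.
  by rewrite /W1; split=> //=; [lra|lra|case; split=> //=; lra].
move=> n2 En2 [w2 o2].
case/(@visits_left_cut _ _ rI rIV W1 (W1 - v - phi * v) _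
    (pent_iet (u - phi * v) v)): En2.
  by rewrite /W1; split=> //=; [lra|lra|case; split=> //=; lra].
move=> n3 En3 [w3 o3]; exists n3 => //.
have [[? ?] ?] := (o1 rI isT, o1 rII isT, o1 rIV isT).
have [[? ?] ?] := (o2 rII isT, o2 rIII isT, o2 rIV isT).
have [[? ?] ?] := (o3 rII isT, o3 rIII isT, o3 rIV isT).
by split; lia.
Qed.

(** IV wins against III on the right, I against II on the left, and then on
    the right I against IV, III against I and II against III.  The final
    orders are I, IV, II, III and IV, III, I, II: those of the family once the
    letters I, IV, II, III are renamed I, II, III, IV. *)
Lemma visits_pent_iet_near u v n :
    0 <= v -> v <= u <= phi * v -> visits (pent_iet u v) n ->
  exists2 n', visits (pent_iet (phi * (u - v)) (phi * v - u)) n'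
  & [/\ n rI = n' rI + n' rII + n' rIII + n' rIV, n rII = n' rIII + n' rIV,
       n rIII = n' rI + n' rIV & n rIV = n' rI + n' rII + n' rIV]%N.
Proof.
move=> v0 /andP[vu uv].
have p1 := phi_ge1.
have f1 : phi * (phi * v) = phi * v + v by rewrite mulrA phi_sqr; ring.
have f1' : phi * (phi * u) = phi * u + u by rewrite mulrA phi_sqr; ring.
have f2 : phi * v <= phi * u by rewrite ler_pM2l.
have f2' : phi * u <= phi * (phi * v) by rewrite ler_pM2l.
have f3 : v <= phi * v by rewrite ler_peMl.
have f4 : u <= phi * u by rewrite ler_peMl; lra.
case/(@visits_right_cut _ _ rIV rIII _ (Iet
  (roman_fun 0 (phi * u) (phi * u + v) (phi * u + v + u))
  (roman_fun (v + phi * v) 0 (v + phi * v - u) v)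
  (roman_fun (phi * u) v u (phi * v - u)))).
  by split=> //=; [lra|case; split=> //=; lra].
move=> n1 En1 [w1 o1].
pose W1 := phi * u + v + phi * v.
case/(@visits_left_cut _ _ rI rII W1 (W1 - v) _ (Iet
  (roman_fun 0 (phi * u - v) (phi * u) (phi * u + u))
  (roman_fun (v + phi * v) (phi * v) (phi * v - u) 0)
  (roman_fun (phi * u - v) v u (phi * v - u)))): En1.
  by rewrite /W1; split=> //=; [lra|lra|case; split=> //=; lra].
move=> n2 En2 [w2 o2].
case/(@visits_right_cut_img _ _ rI rIV _ (Iet
  (roman_fun 0 (phi * u - v) (phi * u) (phi * u - phi * v + u - v))
  (roman_fun (v + phi * v) (phi * v) (phi * v - u) 0)
  (roman_fun (phi * u - v - phi * v + u) v u (phi * v - u)))): En2.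
  by split=> //=; [lra|lra|case; split=> //=; lra].
move=> n3 En3 [w3 o3].
case/(@visits_right_cut _ _ rIII rI _ (Iet
  (roman_fun 0 (phi * u - v) (phi * u) (phi * u - phi * v + u - v))
  (roman_fun (v + 2 * (phi * v) - u - phi * u) (phi * v) (phi * v - u) 0)
  (roman_fun (phi * u - v - phi * v + u) v (v + phi * v - phi * u)
    (phi * v - u)))): En3.
  by split=> //=; [lra|lra|case; split=> //=; lra].
move=> n4 En4 [w4 o4].
case/(@visits_right_cut_img _ _ rII rIII _ (Iet
  (roman_fun 0 (phi * u - v) (2 * (phi * u) - phi * v - v)
    (phi * u - phi * v + u - v))
  (roman_fun (v + 2 * (phi * v) - u - phi * u) (phi * v) (phi * v - u) 0)
  (roman_fun (phi * u - v - phi * v + u) (phi * u - phi * v)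
    (v + phi * v - phi * u) (phi * v - u)))): En4.
  by split=> //=; [lra|lra|case; split=> //=; lra].
move=> n5 En5 [w5 o5].
exists (n5 \o roman_fun rI rIV rII rIII).
  apply: (@visits_relabel _ _ _ (roman_fun rI rIII rIV rII)) En5; try by case.
  by case; split=> /=; lra.
have [[? ?] ?] := (o1 rI isT, o1 rII isT, o1 rIII isT).
have [[? ?] ?] := (o2 rII isT, o2 rIII isT, o2 rIV isT).
have [[? ?] ?] := (o3 rII isT, o3 rIII isT, o3 rIV isT).
have [[? ?] ?] := (o4 rI isT, o4 rII isT, o4 rIV isT).
have [[? ?] ?] := (o5 rI isT, o5 rIII isT, o5 rIV isT).
by split=> /=; lia.
Qed.

Lemma sum_letters (V : nmodType) (F : roman -> V) (s : seq (roman * R)) n :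
    (forall a, count (fun p => p.1 == a) s = n a) ->
  \sum_(p <- s) F p.1 =
    F rI *+ n rI + F rII *+ n rII + F rIII *+ n rIII + F rIV *+ n rIV.
Proof.
move=> ns; rewrite -!ns -!sum_pred -!sumrMnr -!big_split /=.
by apply: eq_bigr => p _; case: p.1; rewrite /= ?mulr0n ?add0r ?addr0.
Qed.

Lemma visits_gt0 E n : @visits R roman E n ->
  (0 < n rI + n rII + n rIII + n rIV)%N.
Proof.
case=> [[|p s] // _ ns]; have : (0 < n p.1)%N by rewrite -ns /= eqxx.
by case: p.1; lia.
Qed.

(** Reversing the segment and exchanging I with IV and II with III
    exchanges u with v. *)
Lemma visits_pent_iet_swap u v n :
  visits (pent_iet u v) n ->
  visits (pent_iet v u) (n \o roman_fun rIV rIII rII rI).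
Proof.
pose W := phi * u + v + u + phi * v.
move=> En; have {En} : visits (mirror W (pent_iet u v)) n.
  exact: visits_mirror En.
apply: (@visits_relabel _ _ _ (roman_fun rIV rIII rII rI)); try by case.
by rewrite /W; case; split=> /=; ring.
Qed.

(** For v = 0 the intervals II and IV are empty, and I and III do not move, so
    that periodic orbits are single points. *)
Lemma visits_pent_iet_axis u m : visits (pent_iet u 0) m ->
  m =1 roman_fun 0 0 1 0 \/ m =1 roman_fun 1 0 0 0.
Proof.
case=> s /and3P[s0 cs us] ms.
have fixed p q : moves (pent_iet u 0) p q -> q = p.
  case: p q => [a x] [b y] /and3P[/andP[/= x1 x2] /andP[/= y1 y2] /eqP/= yE].
  have yx : y = x by move: yE x1 x2; case: a => /=; lra.
  rewrite yx in y1 y2 *; congr pair.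
  by case: a b x1 x2 y1 y2 {yE} => [] [] //= *; exfalso; lra.
case: s s0 cs us ms => // p [|q s] _ /=; last first.
  by case/andP=> /fixed ->; rewrite inE eqxx.
rewrite andbT => /and3P[/andP[p1 p2] _ _] _ mp.
have [pI|pIII] : p.1 = rI \/ p.1 = rIII.
- by move: p1 p2; case: p.1 => /= p1 p2; try (by left); try (by right);
    exfalso; lra.
- by right => a; rewrite -mp pI; case: a.
- by left => a; rewrite -mp pIII; case: a.
Qed.

(** Multiplication by phi of the pair (phi c + e, phi f + d), where
    (c, d, e, f) are the values of P at I, II, III, IV. *)
Definition golden_mul (P : roman -> nat) : roman -> nat :=
  roman_fun (P rI + P rIII)%N (P rIV) (P rI) (P rII + P rIV)%N.

(** By induction on the size of one count vector n, whose decrease makes the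
    algorithm stop.  The vector P is transported back by the
    matrix of each step, and this matrix commutes with [golden_mul]. *)
Lemma visits_pent_iet_dichotomy u v n :
    0 <= u -> 0 <= v -> visits (pent_iet u v) n ->
  exists P, forall m, visits (pent_iet u v) m -> m =1 P \/ m =1 golden_mul P.
Proof.
have [N] := ubnP (n rI + n rII + n rIII + n rIV)%N.
elim: N => // N IHN in u v n *; rewrite ltnS => nN.
wlog vu : u v n nN / v <= u.
  move=> IH u0 v0 En; have [vu|/ltW uv] := lerP v u; first exact: IH En.
  have [] := IH v u _ _ uv v0 u0 (visits_pent_iet_swap En).
    by rewrite /=; lia.
  move=> P IHP; exists (P \o roman_fun rIV rIII rII rI).
  move=> m /visits_pent_iet_swap /IHP[] mP; [left|right].
    by move=> a; rewrite /= -mP; case: a.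
  move=> a; have := mP (roman_fun rIV rIII rII rI a).
  by case: a => /= ->; rewrite // addnC.
move=> u0 v0 En; have n_gt0 := visits_gt0 En.
have [v_eq0|v_neq0] := eqVneq v 0.
  rewrite v_eq0; exists (roman_fun 0 0 1 0)%N.
  by move=> m /visits_pent_iet_axis[] mP; [left|right].
have p1 := phi_ge1.
have [far|/ltW near] := lerP (phi * v) u.
  have [n' En' [nI nII nIII nIV]] := visits_pent_iet_far v0 far En.
  have [||P IHP] := IHN _ _ _ _ _ v0 En'; [|by lra|].
    apply: leq_trans nN.
    suff : (0 < n rII + n rIV)%N by lia.
    (* Otherwise the orbit visits I and III only, and always moves right. *)
    rewrite lt0n addn_eq0; apply/negP => /andP[/eqP n2 /eqP n4].
    case: En => s /and3P[s0 cs us] ns.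
    pose jump a := img (pent_iet u v) a - dom (pent_iet u v) a.
    have : \sum_(p <- s) jump p.1 = 0.
      apply: (addrI (\sum_(p <- s) p.2)); rewrite addr0 -big_split /=.
      apply/esym/(cycle_sum _ cs) => p q /and3P[_ _ /eqP ->].
      by rewrite /jump; ring.
    rewrite (sum_letters _ ns) n2 n4 !mulr0n !addr0 /jump /=.
    have v_gt0 : 0 < v by rewrite lt_neqAle eq_sym v_neq0.
    have f3 : 0 < phi * v by rewrite mulr_gt0.
    rewrite !subr0 (_ : _ - _ = phi * v); last by ring.
    move/eqP; rewrite paddr_eq0 ?mulrn_wge0 //; [|lra|lra].
    rewrite !mulrn_eq0 (gt_eqF f3) (gt_eqF (addr_gt0 v_gt0 f3)) !orbF.
    by case/andP=> /eqP n1 /eqP n3; rewrite n1 n2 n3 n4 in n_gt0.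
  exists (roman_fun (P rI + P rII + P rIV) (P rII) (P rIII + P rIV) (P rIV))%N.
  move=> m /(visits_pent_iet_far v0 far)[m' /IHP m'P].
  case=> mI mII mIII mIV.
  by case: m'P => m'P; [left|right]; case; rewrite ?(mI, mII, mIII, mIV) /=;
    rewrite !m'P /=; lia.
have vuv : v <= u <= phi * v by rewrite vu.
have [n' En' [nI nII nIII nIV]] := visits_pent_iet_near v0 vuv En.
have [|||P IHP] := IHN _ _ _ _ _ _ En'.
- by lia.
- by rewrite mulr_ge0 ?subr_ge0 // ltW.
- by rewrite subr_ge0.
exists (roman_fun (P rI + P rII + P rIII + P rIV) (P rIII + P rIV)
  (P rI + P rIV) (P rI + P rII + P rIV))%N.
move=> m /(visits_pent_iet_near v0 vuv)[m' /IHP m'P].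
case=> mI mII mIII mIV.
by case: m'P => m'P; [left|right]; case; rewrite ?(mI, mII, mIII, mIV) /=;
  rewrite !m'P /=; lia.
Qed.

End Golden.

(** * Angles of the regular pentagon *)
Section Angles.
Variable R : realType.

Lemma degD (x y : R) : deg (x + y) = deg x + deg y.
Proof. by rewrite /deg; ring. Qed.

Lemma degB (x y : R) : deg (x - y) = deg x - deg y.
Proof. by rewrite /deg; ring. Qed.

Lemma deg180 : deg 180 = pi :> R.
Proof. by rewrite /deg; field. Qed.

(** The constants are separate variables tied by an equation so that decimal
    angles can be given as they stand. *)
Lemma sin_sub_deg (a b x : R) : b = a + 180 ->
  sin (x - deg b) = - sin (x - deg a).
Proof.
move=> ->; rewrite degD deg180 opprD addrA.
by rewrite -[in RHS](subrK pi (x - deg a)) sinDpi opprK.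
Qed.

Lemma deg0 : deg 0 = 0 :> R.
Proof. by rewrite /deg; ring. Qed.

Lemma degN (x : R) : deg (- x) = - deg x.
Proof. by rewrite /deg; ring. Qed.

Definition golden : R := 2 * cos (deg 36).

(** sin (y - 36) + sin (y + 36) = 2 cos 36 sin y; this is the only source of
    golden proportions in the pentagon. *)
Lemma sin_recurrence (a b c x : R) : b = a + 36 -> c = a + 72 ->
  sin (x - deg c) = golden * sin (x - deg b) - sin (x - deg a).
Proof.
move=> -> ->; have -> : a + 72 = a + 36 + 36 by ring.
rewrite (degD _ 36).
have -> : x - deg a = x - deg (a + 36) + deg 36 by rewrite degD; ring.
rewrite opprD addrA; move: (x - deg (a + 36)) => y.
by rewrite sinB sinD /golden; ring.
Qed.

Lemma sin_deg_gt0 (a : R) : 0 < a < 180 -> 0 < sin (deg a).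
Proof.
case/andP=> a0 a180; apply: sin_gt0_pi; rewrite -deg180 /deg.
have p0 := pi_gt0 R.
by rewrite divr_gt0 ?mulr_gt0 //= ltr_pM2r ?invr_gt0 // ltr_pM2r.
Qed.

Lemma golden_gt0 : 0 < golden.
Proof.
rewrite mulr_gt0 // cos_gt0_pihalf // /deg.
by have := pi_gt0 R; lra.
Qed.

(** Two steps of the recurrence express sin 108 in terms of sin 36, and
    sin 108 = sin 72. *)
Lemma golden_sqr : golden * golden = golden + 1.
Proof.
have s36 : sin (deg 36 : R) != 0 by rewrite gt_eqF // sin_deg_gt0 //; lra.
apply: (mulIf s36).
have rec x := @sin_recurrence 0 36 72 x (esym (add0r _)) (esym (add0r _)).
have s72 : sin (deg 72) = golden * sin (deg 36).
  have := rec (deg 72); rewrite -!degB subrr subr0 deg0 sin0.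
  by rewrite (_ : 72 - 36 = 36); [lra|ring].
have s108 : sin (deg 108) = sin (deg 72) :> R.
  have := @sin_sub_deg 0 180 (deg 108) (esym (add0r _)); rewrite -!degB subr0.
  by rewrite (_ : 108 - 180 = - 72) ?degN ?sinN => [/oppr_inj -> //|]; ring.
have := rec (deg 108); rewrite -!degB subr0 s108.
have -> : 108 - 72 = 36 :> R by ring.
have -> : 108 - 36 = 72 :> R by ring.
rewrite s72 => e.
by rewrite -mulrA (mulrDl golden 1) mul1r {3}e addrCA subrr addr0.
Qed.

(** * Convexity of the pentagon *)
Definition cross (p q : plane R) : R := p.1 * q.2 - p.2 * q.1.

Lemma crossDl p q r : cross (p + q) r = cross p r + cross q r.
Proof. by rewrite /cross /=; ring. Qed.
Lemma crossZl a p r : cross (a *: p) r = a * cross p r.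
Proof. by rewrite /cross /= /GRing.scale /=; ring. Qed.
Lemma crossNl p r : cross (- p) r = - cross p r.
Proof. by rewrite /cross /=; ring. Qed.
Lemma crossDr p q r : cross r (p + q) = cross r p + cross r q.
Proof. by rewrite /cross /=; ring. Qed.
Lemma crossZr a p r : cross r (a *: p) = a * cross r p.
Proof. by rewrite /cross /= /GRing.scale /=; ring. Qed.
Lemma crossNr p r : cross r (- p) = - cross r p.
Proof. by rewrite /cross /=; ring. Qed.

Lemma cross0r r : cross r 0 = 0.
Proof. by rewrite /cross /= !mulr0 subr0. Qed.

Lemma cross_dir a b : cross (dir a) (dir b) = sin (b - a).
Proof. by rewrite /cross /= sinB; ring. Qed.

Definition edge (k : nat) : plane R := dir (deg (72 * k%:R)).

Lemma vertexS k : vertex R k.+1 = vertex R k + edge k.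
Proof. by rewrite /vertex big_ord_recr. Qed.

Lemma vertex0 : vertex R 0 = 0.
Proof. by rewrite /vertex big_ord0. Qed.

Lemma on_sideE b (k : 'I_5) p : on_side b k p ->
  exists2 t : R, 0 < t < 1 & (-1) ^+ b *: p = vertex R k + t *: edge k.
Proof.
case=> t t01 ->; exists t; first exact: t01.
rewrite scalerA -expr2 sqrr_sign scale1r vertexS scalerDr addrA.
by rewrite -scalerDl subrK scale1r.
Qed.

(** The sines of the multiples of 72, written with two of them. *)
Definition pent_sin (n : nat) : R :=
  nth 0 [:: 0; sin (deg 72); sin (deg 36); - sin (deg 36); - sin (deg 72)] n.

Lemma sin_pent n : (n < 5)%N -> sin (deg (72 * n%:R)) = pent_sin n.
Proof.
have half a b : b = a + 180 -> sin (deg b) = - sin (deg a) :> R.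
  by move=> ->; rewrite degD deg180 sinDpi.
have s1 : sin (deg 144) = sin (deg 36) :> R.
  by rewrite (half (- 36)) ?degN ?sinN ?opprK //; ring.
case: n => [|[|[|[|[|//]]]]] _; rewrite /pent_sin /=.
- by rewrite mulr0 deg0 sin0.
- by rewrite mulr1.
- by rewrite -s1; congr (sin (deg _)); ring.
- by rewrite (half 36) //; ring.
- rewrite (half 108); last by ring.
  by rewrite (half (- 72)) ?degN ?sinN ?opprK //; ring.
Qed.

Lemma cross_edge k i : (k < 5)%N -> (i < 5)%N ->
  cross (edge k) (edge i) =
    if (k <= i)%N then pent_sin (i - k) else - pent_sin (k - i).
Proof.
move=> k5 i5; rewrite cross_dir -degB -mulrBr.
case: leqP => [ki|/ltnW ik].
  by rewrite -natrB // sin_pent // (leq_ltn_trans (leq_subr _ _)).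
rewrite -opprB mulrN degN sinN -natrB // sin_pent //.
by rewrite (leq_ltn_trans (leq_subr _ _)).
Qed.

(** Interior points of the other sides lie strictly to the left of the line
    carrying side k, and for the flipped pentagon strictly to the right. *)
Lemma side_convex (k k' : 'I_5) b p q :
    on_side b k p -> on_side b k' q -> k != k' ->
  0 < (-1) ^+ b * cross (edge k) (q - p).
Proof.
move=> /on_sideE[t _ pE] /on_sideE[t' /andP[t'0 t'1] qE].
rewrite -crossZr scalerBr pE qE.
have h0 : 0 < sin (deg 72) :> R by rewrite sin_deg_gt0 //; lra.
have g0 : 0 < sin (deg 36) :> R by rewrite sin_deg_gt0 //; lra.
have h1 : 0 < t' * sin (deg 72) by rewrite mulr_gt0.
have g1 : 0 < t' * sin (deg 36) by rewrite mulr_gt0.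
have h2 : t' * sin (deg 72) < sin (deg 72) by rewrite gtr_pMl.
have g2 : t' * sin (deg 36) < sin (deg 36) by rewrite gtr_pMl.
case: k k' {pE qE p q} => [] [|[|[|[|[|//]]]]] ? [] [|[|[|[|[|//]]]]] ? //= _.
all: rewrite !(vertexS, vertex0) !(crossDr, crossNr, crossZr).
all: rewrite ?cross0r ?cross_edge //.
all: rewrite /pent_sin /=.
all: move: (sin (deg 72)) (sin (deg 36)) h0 g0 h1 g1 h2 g2 => h g.
all: move=> h0 g0 h1 g1 h2 g2.
all: lra.
Qed.

End Angles.

(** * From trajectories to periodic orbits *)

(** Chords have real components, so their equality is decided classically. *)
HB.instance Definition _ (R : realType) := gen_eqMixin (chord R).

Section Trajectories.
Variables (R : realType) (theta : R).
Hypothesis theta_sector : sector3 theta.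

Local Notation phi := (golden R).
(** The widths of the sides labelled 5 and 1 seen in the direction theta; they
    vanish at the ends 72 and 108 of the sector. *)
Definition width5 : R := sin (theta - deg 72).
Definition width1 : R := sin (deg 108 - theta).
Local Notation u := width5.
Local Notation v := width1.
Local Notation vertex := (vertex R).
Local Notation edge := (edge R).

Lemma width5_ge0 : 0 <= u.
Proof.
apply: sin_ge0_pi; case/andP: theta_sector; rewrite -deg180 -subr_ge0 => -> le.
rewrite lerBlDr (le_trans le) // -degD /deg !ler_pM2r ?invr_gt0 ?pi_gt0 //.
by lra.
Qed.

Lemma width1_ge0 : 0 <= v.
Proof.
apply: sin_ge0_pi; case/andP: theta_sector => le.
rewrite -deg180 -subr_ge0 => ->.
rewrite lerBlDr -lerBlDl (le_trans _ le) // -degB.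
by rewrite /deg !ler_pM2r ?invr_gt0 ?pi_gt0 //; lra.
Qed.

Lemma sin_theta_gt0 : 0 < sin theta.
Proof.
apply: sin_gt0_pi; case/andP: theta_sector => le1 le2.
have p0 := pi_gt0 R; rewrite /deg in le1 le2; apply/andP; split; lra.
Qed.

(** The coordinate transverse to the direction theta, increasing from left to
    right. *)
Definition across (p : plane R) : R := cross p (dir theta).

(** The recurrence of step 36 determines all the widths from the two smallest
    ones, which are sin (theta - 72) and - sin (theta - 108). *)
Lemma across_edge k : (k < 5)%N ->
  across (edge k) = nth 0 [:: phi * u + phi * v; u; - (u + phi * v);
                              - (phi * u + v); v] k.
Proof.
have e108 : sin (theta - deg 108) = - v by rewrite /v -sinN opprB.
have e36 : sin (theta - deg 36) = phi * u + v.
  have := @sin_recurrence _ 36 72 108 theta; rewrite e108 -/u => e.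
  by rewrite -[LHS](subKr (phi * u)) -e ?opprK; [|ring..].
have e0 : sin (theta - deg 0) = phi * u + phi * v.
  have := @sin_recurrence _ 0 36 72 theta (esym (add0r _)) (esym (add0r _)).
  rewrite e36 -/u => e; rewrite -[LHS](subKr (phi * (phi * u + v))) -e.
  by rewrite mulrDr mulrA golden_sqr mulrDl mul1r; ring.
have e144 : sin (theta - deg 144) = - (u + phi * v).
  rewrite (@sin_recurrence _ 72 108 144 theta) ?e108 -/u; [|ring..].
  by rewrite mulrN opprD addrC.
case: k => [|[|[|[|[|//]]]]] _; rewrite /across cross_dir /=.
- by rewrite mulr0.
- by rewrite mulr1.
- by rewrite -e144; congr (sin (_ - deg _)); ring.
- by rewrite (@sin_sub_deg _ 36) ?e36 //; ring.
- by rewrite (@sin_sub_deg _ 108) ?e108 ?opprK //; ring.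
Qed.

Lemma across_vertex k : (k <= 5)%N ->
  across (vertex k) =
    nth 0 [:: 0; phi * u + phi * v; phi * u + phi * v + u; phi * u; - v; 0] k.
Proof.
have S j : across (vertex j.+1) = across (vertex j) + across (edge j).
  by rewrite vertexS /across crossDl.
have v0 : across (vertex 0) = 0.
  by rewrite vertex0 /across /cross /= !mul0r subr0.
case: k => [|[|[|[|[|[|//]]]]]] _; rewrite ?S v0 ?across_edge //=; ring.
Qed.

(** By convexity a chord points to the inner side of the side where it enters
    and to the outer side of the side where it leaves. *)
Lemma chord_signs c : is_chord theta c ->
  0 < (-1) ^+ polygon c * across (edge (side_in c)) /\
  (-1) ^+ polygon c * across (edge (side_out c)) < 0.
Proof.
case=> sin_c sout_c neq L0.
have fE : finish theta c - start c = chord_length c *: dir theta.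
  by rewrite /finish addrC addKr.
have crossE k p q : cross (edge k) (p - q) = - cross (edge k) (q - p).
  by rewrite -crossNr opprB.
split.
  have := side_convex sin_c sout_c neq; rewrite fE crossZr mulrCA pmulr_rgt0 //.
have := side_convex sout_c sin_c; rewrite eq_sym => /(_ neq).
by rewrite crossE fE crossZr mulrN mulrCA -mulrN pmulr_rgt0 // oppr_gt0.
Qed.

Lemma acrossD p q : across (p + q) = across p + across q.
Proof. exact: crossDl. Qed.

Lemma acrossN p : across (- p) = - across p.
Proof. exact: crossNl. Qed.

Lemma acrossZ a p : across (a *: p) = a * across p.
Proof. exact: crossZl. Qed.

Lemma across_finish c : across (finish theta c) = across (start c).
Proof. by rewrite acrossD acrossZ /across cross_dir subrr sin0 mulr0 addr0. Qed.

Lemma on_side_across b (k : 'I_5) p : on_side b k p ->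
  exists2 t : R, 0 < t < 1
  & (-1) ^+ b * across p = across (vertex k) + t * across (edge k).
Proof.
move=> /on_sideE[t t01 pE]; exists t; first exact: t01.
by rewrite -!acrossZ -acrossD -pE.
Qed.

(** The chords of P' spell exactly one block; rI is a default for the others. *)
Definition letter (c : chord R) : roman :=
  head rI [seq a <- [:: rI; rII; rIII; rIV]
          | block a == [:: label (side_in c); label (side_out c)]].

(** The sum of the ends of side k is the translation of the gluing along it. *)
Definition ends (k : nat) : plane R := vertex k + vertex k.+1.

(** The entering point, seen on the boundary of P before the gluing and
    measured from the left end of the side labelled 4, the leftmost
    of the two upper sides of P. *)
Definition entry (c : chord R) : R := across (start c + ends (side_in c)) + v.

(** The vertical component of the holonomy of a block; the transverse component
    is the displacement in the interval exchange. *)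
Definition rise : roman -> R :=
  roman_fun (2 * sin (deg 72) + sin (deg 36)) (sin (deg 72) + sin (deg 36))
            (sin (deg 72) + sin (deg 36)) (2 * sin (deg 72) + sin (deg 36)).

Lemma height_ends k : (k < 5)%N ->
  (ends k).2 = nth 0 [:: 0; sin (deg 72); 2 * sin (deg 72) + sin (deg 36);
                      2 * sin (deg 72) + sin (deg 36); sin (deg 72)] k.
Proof.
have D2 (p q : plane R) : (p + q).2 = p.2 + q.2 by [].
have edge2 j : (j < 5)%N -> (edge j).2 = pent_sin R j by apply: sin_pent.
case: k => [|[|[|[|[|//]]]]] _;
  rewrite /ends !(vertexS, vertex0) !D2 !edge2 //= /pent_sin /=; ring.
Qed.

(** Since the direction is in the sector, a chord of P' enters by a side
    labelled 2 or 4 and leaves by one labelled 1, 3 or 5; the combinations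
    45 and 21 are excluded as the sides do not face each other in the
    direction theta.  The overlap of the two sides is the interval of the
    block. *)
Lemma flipped_chord c : is_chord theta c -> polygon c ->
  let E := pent_iet phi u v in let a := letter c in
  [/\ block a = [:: label (side_in c); label (side_out c)],
      inside E (a, entry c),
      img E a - dom E a =
        across (ends (side_out c)) - across (ends (side_in c))
    & rise a = (ends (side_in c)).2 - (ends (side_out c)).2].
Proof.
move=> c_chord c_up; have [] := chord_signs c_chord.
case: c_chord => /on_side_across[t /andP[t0 t1] xin].
move=> /on_side_across[t' /andP[t'0 t'1] xout] _ _.
rewrite {}c_up expr1 !mulN1r across_finish in xin xout * => sin_lt0 sout_gt0.
have between (s x : R) : 0 < s -> s < 1 -> 0 < x -> 0 < s * x /\ s * x < x.
  by move=> s0 s1 x0; rewrite mulr_gt0 // gtr_pMl.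
have [tin0 tin1] := between _ _ t0 t1 sin_lt0.
have [tout0 tout1] := between _ _ t'0 t'1 (etrans (esym (oppr_lt0 _)) sout_gt0).
have u0 := width5_ge0; have v0 := width1_ge0.
have phi0 := golden_gt0 R.
have pu : 0 <= phi * u by rewrite mulr_ge0 // ltW.
have pv : 0 <= phi * v by rewrite mulr_ge0 // ltW.
move: xin xout sin_lt0 sout_gt0 tin0 tin1 tout0 tout1 {between}.
rewrite /letter /label /entry acrossD !height_ends ?ltn_ord //.
rewrite /ends !acrossD.
rewrite !across_vertex ?across_edge ?(ltnW (ltn_ord _)) ?ltn_ord //.
move: (across (start c)) (side_in c) (side_out c) => x [k k5] [j j5] /=.
move: u v u0 v0 phi phi0 pu pv => {c} u v u0 v0 phi phi0 pu pv.
case: k k5 => [|[|[|[|[|//]]]]] _ /=; case: j j5 => [|[|[|[|[|//]]]]] _ /=.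
all: move=> xin xout sin_lt0 sout_gt0 tin0 tin1 tout0 tout1.
all: first [by exfalso; lra
           | split; [by []|apply/andP; split=> /=; lra|ring|ring]].
Qed.

Lemma label_inj : injective label.
Proof.
by case=> [[|[|[|[|[|//]]]]] k5] [[|[|[|[|[|//]]]]] j5] //= _; apply: val_inj.
Qed.

Lemma on_side_inj b (k : 'I_5) p q : across (edge k) != 0 ->
  on_side b k p -> on_side b k q -> across p = across q -> p = q.
Proof.
move=> ek0 /[dup] /on_sideE[t _ pE] /on_side_across _ /on_sideE[t' _ qE] pq.
apply: (can_inj (signrZK b)); rewrite pE qE.
have : across ((-1) ^+ b *: p) = across ((-1) ^+ b *: q) by rewrite !acrossZ pq.
by rewrite pE qE !acrossD !acrossZ => /addrI/(mulIf ek0) ->.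
Qed.

(** The letter gives the side of entry, and this side is transverse to the
    direction by [chord_signs]. *)
Lemma flipped_chord_inj c c' : is_chord theta c -> is_chord theta c' ->
    polygon c -> polygon c' -> letter c = letter c' -> entry c = entry c' ->
  (polygon c, start c) = (polygon c', start c').
Proof.
move=> hc hc' up up'.
have [bc _ _ _] := flipped_chord hc up.
have [bc' _ _ _] := flipped_chord hc' up'.
move=> ll; rewrite ll bc' in bc; case: bc => /label_inj kk _.
rewrite /entry kk => /addIr; rewrite !acrossD => /addIr ss.
have [sg _] := chord_signs hc.
case: hc hc' => [oc _ _ _] [oc' _ _ _]; rewrite up up' kk in oc oc' *.
congr pair; apply: on_side_inj oc oc' ss.
by apply: contraTneq sg; rewrite -kk => ->; rewrite mulr0 ltxx.
Qed.

(** Carrying the validity of the chords in the relation makes the lemmas on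
    cycles applicable. *)
Definition linked : rel (chord R) :=
  fun c c' => [&& `[< is_chord theta c >], `[< is_chord theta c' >]
                & continues theta c c'].

Lemma closed_linked s : closed_trajectory theta s ->
  all (fun c => `[< is_chord theta c >]) s /\ cycle linked s.
Proof.
case=> _ chords cs _.
have chord_s : all (fun c => `[< is_chord theta c >]) s.
  by rewrite -[s]/(val (in_tuple s)); apply/all_tnthP => i; apply/asboolP.
split=> //; apply: (sub_in_cycle _ chord_s cs) => c c' hc hc' cc'.
exact/and3P.
Qed.

(** Passing through P between two chords of P' does not change the transverse
    coordinate, so that the two gluings alone move the entering point. *)
Lemma linked_entry c c' c'' : linked c c' -> linked c' c'' -> ~~ polygon c' ->
  polygon c /\
  moves (pent_iet phi u v) (letter c, entry c) (letter c'', entry c'').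
Proof.
case/and3P=> /asboolP hc _ /and3P[/eqP p' /eqP k' /eqP s'].
case/and3P=> _ /asboolP hc'' /and3P[/eqP p'' /eqP k'' /eqP s''] low.
rewrite low in p''; rewrite p' negbK in low; split=> //.
have [_ ic dc _] := flipped_chord hc low.
have [_ ic'' _ _] := flipped_chord hc'' p''.
have glue (p : bool) k x :
    across (gluing p k x) = across x - (-1) ^+ p * across (ends k).
  by rewrite /gluing acrossD acrossN acrossZ.
apply/and3P; split; [exact: ic|exact: ic''|apply/eqP].
move: dc; rewrite /entry (acrossD (start c)) (acrossD (start c'')).
rewrite s'' k'' glue across_finish p' s' glue low across_finish.
rewrite expr0 expr1 /=.
lra.
Qed.

(** A chord of P leaves by the side by which the next chord, which is in P',
    enters. *)
Lemma sum_unflipped_exits (V : nmodType) (G : 'I_5 -> V) s : cycle linked s ->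
  \sum_(c <- s | ~~ polygon c) G (side_out c) =
  \sum_(c <- s | polygon c) G (side_in c).
Proof.
move=> cs; rewrite big_mkcond [RHS]big_mkcond; symmetry; apply: cycle_sum cs.
by move=> c c' /and3P[_ _ /and3P[/eqP -> /eqP -> _]].
Qed.

Definition flipped_orbit (s : seq (chord R)) : seq (roman * R) :=
  [seq (letter c, entry c) | c <- s & polygon c].

Lemma flipped_orbitP s : closed_trajectory theta s ->
  periodic_orbit (pent_iet phi u v) (flipped_orbit s).
Proof.
move=> s_closed; have [chord_s cs] := closed_linked s_closed.
case: s_closed => /eqP s0 _ _ us; apply/and3P; split.
- rewrite -size_eq0 size_map size_eq0 -has_filter.
  case: s s0 cs {us chord_s} => // c [|c' s] _ /=.
    by case/andP=> /and3P[_ _ /andP[/eqP]]; case: polygon.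
  by case/andP=> /and3P[_ _ /andP[/eqP -> _]] _; case: polygon.
- rewrite cycle_map; apply: cycle_filter cs => [c c'|c c'|c c' c''].
  + by case/and3P=> _ _ /andP[/eqP -> _]; case: polygon.
  + by case/and3P=> _ _ /andP[/eqP -> _] ->.
  + by move=> cc' c'c'' /(linked_entry cc' c'c'')[].
- rewrite map_inj_in_uniq ?filter_uniq ?(map_uniq us) // => c c'.
  rewrite !mem_filter => /andP[up cs'] /andP[up' c's] [ll ee].
  apply: (uniq_map_inj us) => //.
  by apply: flipped_chord_inj => //; apply/asboolP; apply: (allP chord_s).
Qed.

Lemma flipped_orbit_blocks s l : closed_trajectory theta s ->
  count_mem l (flatten [seq block p.1 | p <- flipped_orbit s]) =
  count_mem l (symbolic_orbit s).
Proof.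
case/closed_linked => chord_s cs.
rewrite count_flatten -map_comp sumnE big_map big_map big_filter /=.
rewrite /symbolic_orbit count_map -sum_pred.
rewrite [RHS](bigID (@polygon R)) /= [RHS]addnC.
have lower : (\sum_(c <- s | ~~ polygon c) (label (side_out c) == l) =
    \sum_(c <- s | polygon c) (label (side_in c) == l))%N.
  exact: (@sum_unflipped_exits nat (fun k => (label k == l) : nat) _ cs).
rewrite lower -big_split /= big_seq_cond [RHS]big_seq_cond; apply: eq_bigr => c.
case/andP=> /(allP chord_s)/asboolP hc up.
by have [-> _ _ _] := flipped_chord hc up; rewrite /= addn0.
Qed.

Lemma flipped_orbit_length s : closed_trajectory theta s ->
  trajectory_length s * sin theta = \sum_(p <- flipped_orbit s) rise p.1.
Proof.
case/closed_linked => chord_s cs.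
rewrite big_map big_filter mulr_suml.
have D2 (p q : plane R) : (p + q).2 = p.2 + q.2 by [].
have N2 (p : plane R) : (- p).2 = - p.2 by [].
have Z2 a (p : plane R) : (a *: p).2 = a * p.2 by [].
have starts : \sum_(c <- s) (start c).2 =
    \sum_(c <- s) ((start c).2 + (chord_length c * sin theta -
                     (-1) ^+ polygon c * (ends (side_out c)).2)).
  apply: cycle_sum cs => c c' /and3P[_ _ /and3P[_ _ /eqP ->]].
  by rewrite /gluing -/(ends _) !D2 N2 !Z2 addrA.
move/eqP: starts; rewrite big_split /= -[eqbLHS]addr0 (inj_eq (addrI _)).
rewrite eq_sym sumrB subr_eq0 => /eqP ->.
rewrite (bigID (@polygon R)) /=.
rewrite [X in _ + X](eq_bigr (fun c => (ends (side_out c)).2)); last first.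
  by move=> c /negPf ->; rewrite mul1r.
rewrite (@sum_unflipped_exits _ (fun k => (ends k).2) _ cs).
rewrite -big_split /= big_seq_cond [RHS]big_seq_cond; apply: eq_bigr => c.
case/andP=> /(allP chord_s)/asboolP hc up.
by have [_ _ _ ->] := flipped_chord hc up; rewrite up expr1 mulN1r addrC.
Qed.

End Trajectories.

(** The labels 1 and 5 occur in the blocks II and III only, and then 3 and 4
    give IV and I. *)
Lemma block_counts r q :
    (forall l, count_mem l (flatten [seq block x | x <- r]) =
               count_mem l (flatten [seq block x | x <- q])) ->
  forall a, count_mem a r = count_mem a q.
Proof.
have labels (w : seq roman) : [/\
    count_mem 1 (flatten [seq block x | x <- w]) = count_mem rII w,
    count_mem 3 (flatten [seq block x | x <- w]) =
      count_mem rI w + count_mem rIV w,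
    count_mem 4 (flatten [seq block x | x <- w]) =
      count_mem rI w + count_mem rII w
  & count_mem 5 (flatten [seq block x | x <- w]) = count_mem rIII w]%N.
  elim: w => // x w [IH1 IH3 IH4 IH5]; rewrite /= !count_cat IH1 IH3 IH4 IH5.
  by case: x; split=> /=; lia.
move=> rq; have [r1 r3 r4 r5] := labels r; have [q1 q3 q4 q5] := labels q.
have [[[e1 e3] e4] e5] := (rq 1, rq 3, rq 4, rq 5)%N.
by case; lia.
Qed.

(** The counts n come from the trajectory itself; a splitting r into blocks is
    compared with them through the numbers of labels, which do not depend on
    the place where it starts. *)
Lemma closed_visits (R : realType) (theta : R) s :
    sector3 theta -> closed_trajectory theta s ->
  exists n, [/\ visits (pent_iet (golden R) (width5 theta) (width1 theta)) n,
    trajectory_length s * sin theta =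
      rise R rI *+ n rI + rise R rII *+ n rII + rise R rIII *+ n rIII
      + rise R rIV *+ n rIV
  & forall r, roman_of (symbolic_orbit s) r -> forall a, count_mem a r = n a].
Proof.
move=> sector closed; pose o := flipped_orbit theta s.
exists (fun a => count (fun p => p.1 == a) o); split.
- by exists o => //; apply: flipped_orbitP.
- rewrite (flipped_orbit_length sector closed).
  exact: (sum_letters _ (fun=> erefl)).
move=> r [k rE] a; rewrite -(count_map fst (pred1 a)).
apply: block_counts => l; rewrite rE -map_comp.
rewrite (flipped_orbit_blocks sector l closed).
by apply/permP; rewrite perm_rot.
Qed.

Theorem theorem7 (R : realType) (theta : R)
  (theta_sector : sector3 theta) (theta_periodic : periodic_direction theta)
  (r_short r_long : seq roman)
  (short_r : short_roman_orbit theta r_short)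
  (long_r : long_roman_orbit theta r_long)
  (c d e f C D E F : nat)
  (c_def : c = count_mem rI r_short) (d_def : d = count_mem rII r_short)
  (e_def : e = count_mem rIII r_short) (f_def : f = count_mem rIV r_short)
  (C_def : C = count_mem rI r_long) (D_def : D = count_mem rII r_long)
  (E_def : E = count_mem rIII r_long) (F_def : F = count_mem rIV r_long) :
  [/\ C = (c + e)%N, D = f, E = c & F = (d + f)%N].
Proof.
have closedE s := @closed_visits R theta s theta_sector.
have u0 := width5_ge0 theta_sector; have v0 := width1_ge0 theta_sector.
have sin_gt0 := sin_theta_gt0 theta_sector.
have h0 : 0 < sin (deg 72) :> R by rewrite sin_deg_gt0 //; lra.
have g0 : 0 < sin (deg 36) :> R by rewrite sin_deg_gt0 //; lra.
case: short_r => s1 [closed1 [s2 closed2 lt12] rs1].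
case: long_r => s3 [closed3 [s4 closed4 lt43] rs3].
have [n1 [vis1 len1 /(_ _ rs1) cnt1]] := closedE _ closed1.
have [n2 [vis2 len2 _]] := closedE _ closed2.
have [n3 [vis3 len3 /(_ _ rs3) cnt3]] := closedE _ closed3.
have [n4 [vis4 len4 _]] := closedE _ closed4.
have [P nP] :=
  visits_pent_iet_dichotomy (golden_gt0 R) (golden_sqr R) u0 v0 vis1.
pose climb (n : roman -> nat) : R := rise R rI *+ n rI + rise R rII *+ n rII
  + rise R rIII *+ n rIII + rise R rIV *+ n rIV.
(* The blocks I and IV rise more than II and III. *)
have climb_mul : climb P <= climb (golden_mul P).
  have rise_ge0 : 0 <= sin (deg 72) + sin (deg 36) :> R.
    by rewrite addr_ge0 // ltW.
  have rise_le :
    sin (deg 72) + sin (deg 36) <= 2 * sin (deg 72) + sin (deg 36) :> R by lra.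
  rewrite /climb /golden_mul /rise /=.
  move: (_ + _) (2 * _ + _) rise_ge0 rise_le => y x y0 yx.
  move: (P rI) (P rII) (P rIII) (P rIV) => a b k l.
  rewrite -!(mulr_natr x) -!(mulr_natr y) !natrD -subr_ge0.
  rewrite [leRHS](_ : _ = (x - y) * (k%:R + b%:R) + y * (l%:R + a%:R)).
    by rewrite addr_ge0 // mulr_ge0 // ?subr_ge0 // addr_ge0.
  by ring.
have climb_P k k' : k =1 k' -> climb k = climb k'.
  by move=> kk; rewrite /climb !kk.
have ordered m m' s s' : trajectory_length s * sin theta = climb m ->
    trajectory_length s' * sin theta = climb m' ->
    trajectory_length s < trajectory_length s' ->
    visits (pent_iet (golden R) (width5 theta) (width1 theta)) m ->
    visits (pent_iet (golden R) (width5 theta) (width1 theta)) m' ->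
  m =1 P /\ m' =1 golden_mul P.
  move=> sm sm'; rewrite -(ltr_pM2r sin_gt0) sm sm' => lt /nP mP /nP m'P.
  case: mP m'P lt => [] mP [] m'P //;
    rewrite (climb_P _ _ mP) (climb_P _ _ m'P).
  - by rewrite ltxx.
  - by rewrite ltNge climb_mul.
  - by rewrite ltxx.
have [n1P _] := ordered _ _ _ _ len1 len2 lt12 vis1 vis2.
have [_ n3P] := ordered _ _ _ _ len4 len3 lt43 vis4 vis3.
rewrite c_def d_def e_def f_def C_def D_def E_def F_def !cnt1 !cnt3.
by rewrite !n1P !n3P.
Qed.
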